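(* Let $d\ge 1$, let $\widehat{F}_d$ be the free profinite group on $d$ generators, let $H$ be a finite group, and let $\pi:\widehat{F}_d\to H$ be a continuous epimorphism with kernel $R$. Let $\widetilde{I}$ be a closed normal subgroup of $\widehat{F}_d$ with $[R,R]\subseteq\widetilde{I}\subseteq R$, and let $\widetilde{R}=R/\widetilde{I}$. Let $$A(\pi,\widetilde{I})=\{\alpha\in\mathrm{Aut}(\widehat{F}_d):\pi\circ\alpha=\pi\ \text{ and }\ \alpha(\widetilde{I})=\widetilde{I}\},$$ let $\rho:A(\pi,\widetilde{I})\to\mathrm{GL}(\widetilde{R})$ be given by the induced action on $\widetilde{R}$, and let $\beta\in H^2(H,\widetilde{R})$ be the extension class of the exact sequence $$1\to\widetilde{R}\to\widehat{F}_d/\widetilde{I}\to H\to 1 .$$ Let $\mathrm{Aut}_H(\widetilde{R})$ be the group of continuous automorphisms of $\widetilde{R}$ that commute with the action of $H$, and let $\mathrm{Aut}_{H,\beta}(\widetilde{R})=\{\gamma\in\mathrm{Aut}_H(\widetilde{R}):\gamma_*(\beta)=\beta\}$. Then $\rho(A(\pi,\widetilde{I}))=\mathrm{Aut}_{H,\beta}(\widetilde{R})$; in other words, the action of $A(\pi,\widetilde{I})$ on $\widetilde{R}$ gives a surjection $A(\pi,\widetilde{I})\to\mathrm{Aut}_{H,\beta}(\widetilde{R})$.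
   Context: $[R,R]$ is the closed commutator subgroup of $R$, so $\widetilde{R}$ is an abelian profinite group; $H$ acts on it continuously via conjugation in $\widehat{F}_d/\widetilde{I}$. Automorphisms of profinite groups are continuous. For $\gamma\in\mathrm{Aut}_H(\widetilde{R})$, $\gamma_*$ denotes the induced automorphism of $H^2(H,\widetilde{R})$. *)

(* Defs.v *)
From HB Require Import structures.
From mathcomp Require Import fingroup.
From mathcomp Require Import all_boot all_order all_algebra.
From mathcomp Require Import all_classical topology tvs ring_quotient.

Set Implicit Arguments.
Unset Strict Implicit.
Unset Printing Implicit Defensive.

Import GRing.Theory.

Local Open Scope classical_set_scope.
Local Open Scope ring_scope.
Local Open Scope quotient_scope.

HB.mixin Record isTopologicalGroup G of Topological G & monoid.Group G := {
  mulg_continuous : continuous (fun x : G * G => (x.1 * x.2)%g);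
  invg_continuous : continuous (fun x : G => x^-1%g)
}.

#[short(type="topologicalGroupType")]
HB.structure Definition TopologicalGroup :=
  {G of Topological G & monoid.Group G & isTopologicalGroup G}.

Definition profinite (G : topologicalGroupType) : Prop :=
  [/\ compact [set: G], hausdorff_space G & totally_disconnected [set: G]].

(* [F], with basis [x], is free of rank [d] in the category of profinite      *)
(* groups.                                                                    *)
Definition free_profinite (d : nat) (F : topologicalGroupType) (x : 'I_d -> F)
    : Prop :=
  profinite F /\
  forall (G : topologicalGroupType) (y : 'I_d -> G), profinite G ->
    exists! f : F -> G,
      [/\ continuous f, {morph f : u v / (u * v)%g} & forall i, f (x i) = y i].

Section Subgroups.
Variable G : groupType.

Definition subgroup (S : set G) : Prop :=
  S 1%g /\ forall x y, S x -> S y -> S (x * y^-1)%g.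

Record normalSubgroup := NormalSubgroup {
  nsub_set :> set G;
  nsub_subgroup : subgroup nsub_set;
  nsub_conj : forall x y, nsub_set x -> nsub_set (x ^ y)%g
}.

Lemma subgroupV (S : set G) x : subgroup S -> S x -> S x^-1%g.
Proof. by case=> S1 SF Sx; rewrite -div1g; apply: SF. Qed.

Lemma subgroupM (S : set G) x y : subgroup S -> S x -> S y -> S (x * y)%g.
Proof.
move=> hS Sx Sy; rewrite -[y]invgK; apply: hS.2 => //; exact: subgroupV.
Qed.

End Subgroups.

Definition closed_commutator (G : topologicalGroupType) (S : set G) : set G :=
  closure (smallest (@subgroup G)
             [set z | exists x y, [/\ S x, S y & z = [~ x, y]%g]]).

Definition kernel (G H : groupType) (f : G -> H) : set G :=
  [set x | f x = 1%g].

Section Cosets.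
Variables (G : topologicalGroupType) (N : normalSubgroup G).

Definition coset_equiv (x y : G) : bool := `[< nsub_set N (x^-1 * y)%g >].

Lemma coset_equiv_class : equiv_class_of coset_equiv.
Proof.
have hN := nsub_subgroup N.
split=> [x|x y|y x z]; rewrite /coset_equiv.
- by apply/asboolP; rewrite mulVg; exact: hN.1.
- by apply/asbool_equiv_eq; split=> h; have := subgroupV hN h;
    rewrite invgM invgK.
- move=> /asboolP h1 /asboolP h2; apply/asboolP.
  by have := subgroupM hN h1 h2; rewrite mulgA mulgK.
Qed.

Canonical coset_equiv_equiv := EquivRelPack coset_equiv_class.
Canonical coset_equiv_encModRel := defaultEncModRel coset_equiv.

Definition coset_type : Type := quotient_topology {eq_quot coset_equiv}.

HB.instance Definition _ := Topological.on coset_type.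
HB.instance Definition _ := Quotient.on coset_type.

Definition pcoset : G -> coset_type := \pi_coset_type.

Lemma pcosetP x y : pcoset x = pcoset y <-> nsub_set N (x^-1 * y)%g.
Proof.
split; first by move/eqquotP => /asboolP.
by move=> h; apply/eqquotP/asboolP.
Qed.

Lemma pcoset_repr (z : coset_type) : pcoset (repr z) = z.
Proof. exact: reprK. Qed.

Lemma pcoset_surj (z : coset_type) : exists x, pcoset x = z.
Proof. by exists (repr z); rewrite pcoset_repr. Qed.

Lemma pcoset_continuous : continuous pcoset.
Proof. exact: pi_continuous. Qed.

Lemma coset_continuous (Z : topologicalType) (f : coset_type -> Z) :
  continuous f <-> continuous (f \o pcoset).
Proof. exact: quotient_continuous. Qed.

Definition coset_mul (a b : coset_type) : coset_type :=
  pcoset (repr a * repr b)%g.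
Definition coset_inv (a : coset_type) : coset_type := pcoset (repr a)^-1%g.

Lemma coset_mulE x y : coset_mul (pcoset x) (pcoset y) = pcoset (x * y)%g.
Proof.
have hN := nsub_subgroup N.
have /pcosetP hx := pcoset_repr (pcoset x).
have /pcosetP hy := pcoset_repr (pcoset y).
apply/pcosetP; set a := repr _ in hx *; set b := repr _ in hy *.
rewrite invgM.
suff -> : (b^-1 * a^-1 * (x * y) = b^-1 * y * ((a^-1 * x) ^ y))%g.
  by apply: subgroupM => //; exact: nsub_conj.
by rewrite conjgE !mulgA mulgK.
Qed.

Lemma coset_invE x : coset_inv (pcoset x) = pcoset x^-1%g.
Proof.
have hN := nsub_subgroup N.
have /pcosetP hx := pcoset_repr (pcoset x).
apply/pcosetP; set a := repr _ in hx *.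
rewrite invgK.
have -> : (a * x^-1 = ((a^-1 * x)^-1) ^ x^-1)%g.
  by rewrite conjgE invgM !invgK !mulgA mulgV mul1g.
by apply: nsub_conj; exact: subgroupV.
Qed.

Fact coset_mulA : associative coset_mul.
Proof.
move=> a b c; rewrite -[a]pcoset_repr -[b]pcoset_repr -[c]pcoset_repr.
by rewrite !coset_mulE mulgA.
Qed.

Fact coset_mul1 : left_id (pcoset 1%g) coset_mul.
Proof. by move=> a; rewrite -[a]pcoset_repr coset_mulE mul1g. Qed.

Fact coset_mulr1 : right_id (pcoset 1%g) coset_mul.
Proof. by move=> a; rewrite -[a]pcoset_repr coset_mulE mulg1. Qed.

Fact coset_mulV : left_inverse (pcoset 1%g) coset_inv coset_mul.
Proof. by move=> a; rewrite -[a]pcoset_repr coset_invE coset_mulE mulVg. Qed.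

Fact coset_mulrV : right_inverse (pcoset 1%g) coset_inv coset_mul.
Proof. by move=> a; rewrite -[a]pcoset_repr coset_invE coset_mulE mulgV. Qed.

HB.instance Definition _ := isGroup.Build coset_type
  coset_mulA coset_mul1 coset_mulr1 coset_mulV coset_mulrV.

Lemma pcosetM : {morph pcoset : x y / (x * y)%g}.
Proof. by move=> x y; rewrite -coset_mulE. Qed.

Lemma pcosetV : {morph pcoset : x / x^-1%g}.
Proof. by move=> x; rewrite -coset_invE. Qed.

Lemma pcoset1 : pcoset 1%g = 1%g.
Proof. by []. Qed.

Lemma pcoset_eq1 x : pcoset x = 1%g <-> nsub_set N x.
Proof.
rewrite -pcoset1; split=> [/esym/pcosetP|h]; first by rewrite invg1 mul1g.
by apply/esym/pcosetP; rewrite invg1 mul1g.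
Qed.

Lemma mulgl_continuous (a : G) : continuous (fun x : G => (a * x)%g).
Proof.
move=> x.
apply: (@continuous_comp _ _ _ (fun x : G => (a, x)) (fun z => (z.1 * z.2)%g)).
  by apply: cvg_pair => /=; [exact: cvg_cst|exact: cvg_id].
exact: mulg_continuous.
Qed.

Lemma mulgr_continuous (a : G) : continuous (fun x : G => (x * a)%g).
Proof.
move=> x.
apply: (@continuous_comp _ _ _ (fun x : G => (x, a)) (fun z => (z.1 * z.2)%g)).
  by apply: cvg_pair => /=; [exact: cvg_id|exact: cvg_cst].
exact: mulg_continuous.
Qed.

Lemma pcoset_open (U : set G) : open U -> open (pcoset @` U).
Proof.
move=> oU; rewrite /open /= /quotient_open.
have -> : pcoset @^-1` (pcoset @` U) =
    \bigcup_(n in nsub_set N) ((fun x => (x * n)%g) @^-1` U).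
  apply/seteqP; split=> [x [u Uu /esym/pcosetP xu]|x [n Nn /= Ux]].
    by exists (x^-1 * u)%g => //=; rewrite mulgA mulgV mul1g.
  exists (x * n)%g => //; apply/esym/pcosetP.
  by rewrite mulgA mulVg mul1g.
apply: bigcup_open => n _; apply: open_comp => // x _.
exact: mulgr_continuous.
Qed.

Fact coset_mulg_continuous :
  continuous (fun z : coset_type * coset_type => (z.1 * z.2)%g).
Proof.
move=> [a b] W /=.
have [x <-] := pcoset_surj a; have [y <-] := pcoset_surj b.
rewrite -pcosetM => /pcoset_continuous hW.
have [[A B] /= [hA hB] AB] := @mulg_continuous G (x, y) _ hW.
move: hA; rewrite nbhsE => -[U [oU Ux] UA].
move: hB; rewrite nbhsE => -[V [oV Vy] VB].
exists (pcoset @` U, pcoset @` V) => /=.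
  split; apply: open_nbhs_nbhs; split; try exact: pcoset_open.
    by exists x.
  by exists y.
move=> [_ _] /= [[u Uu <-] [v Vv <-]]; rewrite /= -pcosetM.
by apply: (AB (u, v)); split; [exact: UA|exact: VB].
Qed.

Fact coset_invg_continuous : continuous (fun z : coset_type => z^-1%g).
Proof.
apply/coset_continuous.
have -> : (fun z : coset_type => z^-1%g) \o pcoset =
    pcoset \o (fun x : G => x^-1%g) by apply/funext => x /=; rewrite pcosetV.
move=> x; apply: continuous_comp; first exact: invg_continuous.
exact: pcoset_continuous.
Qed.

HB.instance Definition _ := isTopologicalGroup.Build coset_type
  coset_mulg_continuous coset_invg_continuous.

End Cosets.

(* A commutative subgroup, written additively, with the subspace topology.    *)
Section AbelianSubgroup.
Variables (G : topologicalGroupType) (S : set G).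
Hypotheses (hS : subgroup S)
           (hC : forall x y, S x -> S y -> commute x y).

Definition abelian_subgroup of subgroup S &
  (forall x y, S x -> S y -> commute x y) : Type := set_type S.

Local Notation A := (abelian_subgroup hS hC).

HB.instance Definition _ := Topological.copy A (set_type S).

Definition asub_val (a : A) : G := set_val (a : set_type S).
Definition asub_mk (x : G) (Sx : S x) : A := exist _ x (mem_set Sx).

Lemma asub_valP (a : A) : S (asub_val a).
Proof. exact: set_valP. Qed.

Lemma asub_mkK x (Sx : S x) : asub_val (asub_mk Sx) = x.
Proof. by []. Qed.

Lemma asub_val_inj : injective asub_val.
Proof. exact: val_inj. Qed.

Lemma asub_val_continuous : continuous asub_val.
Proof. exact: initial_continuous. Qed.

Lemma asub_continuous (Z : topologicalType) (f : Z -> A) :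
  continuous (asub_val \o f) -> continuous f.
Proof. by move=> cf; apply/continuous_comp_initial. Qed.

Definition asub_zero : A := asub_mk hS.1.
Definition asub_opp (a : A) : A := asub_mk (subgroupV hS (asub_valP a)).
Definition asub_add (a b : A) : A :=
  asub_mk (subgroupM hS (asub_valP a) (asub_valP b)).

Fact asub_addA : associative asub_add.
Proof. by move=> a b c; apply: asub_val_inj; exact: mulgA. Qed.

Fact asub_addC : commutative asub_add.
Proof. by move=> a b; apply: asub_val_inj; apply: hC; exact: asub_valP. Qed.

Fact asub_add0 : left_id asub_zero asub_add.
Proof. by move=> a; apply: asub_val_inj; exact: mul1g. Qed.

Fact asub_addN : left_inverse asub_zero asub_opp asub_add.
Proof. by move=> a; apply: asub_val_inj; exact: mulVg. Qed.

HB.instance Definition _ :=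
  GRing.isZmodule.Build A asub_addA asub_addC asub_add0 asub_addN.

Lemma asub_val0 : asub_val 0 = 1%g. Proof. by []. Qed.
Lemma asub_valD : {morph asub_val : a b / a + b >-> (a * b)%g}.
Proof. by []. Qed.
Lemma asub_valN : {morph asub_val : a / - a >-> a^-1%g}.
Proof. by []. Qed.

Fact asub_sub_continuous : continuous (fun x : A * A => x.1 - x.2).
Proof.
apply: asub_continuous => x.
apply: (@continuous_comp _ _ _
  (fun x : A * A => (asub_val x.1, (asub_val x.2)^-1%g))
  (fun z : G * G => (z.1 * z.2)%g)); last exact: mulg_continuous.
apply: cvg_pair => /=.
  by apply: continuous_comp; [exact: cvg_fst|exact: asub_val_continuous].
apply: (@continuous_comp _ _ _ (fun x : A * A => asub_val x.2)
  (fun z : G => z^-1%g)); last exact: invg_continuous.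
by apply: continuous_comp; [exact: cvg_snd|exact: asub_val_continuous].
Qed.

HB.instance Definition _ :=
  PreTopologicalNmodule_isTopologicalZmodule.Build A asub_sub_continuous.

End AbelianSubgroup.

(* Second cohomology of a finite group [H] with coefficients in an            *)
(* [H]-module, by inhomogeneous cochains. As [H] is discrete, every cochain   *)
(* is continuous, for any topology on the module.                             *)
Record hmodule (H : finGroupType) (A : zmodType) := HModule {
  hact :> H -> A -> A;
  hact1 : forall a, hact 1%g a = a;
  hactM : forall h k a, hact (h * k)%g a = hact h (hact k a);
  hactD : forall h, {morph hact h : a b / a + b}
}.

Section Cohomology.
Variables (H : finGroupType) (A : zmodType) (M : hmodule H A).

Lemma hact0 h : M h 0 = 0.
Proof. by apply: (addrI (M h 0)); rewrite -hactD !addr0. Qed.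

Lemma hactN h : {morph M h : a / - a}.
Proof. by move=> a; apply: (addrI (M h a)); rewrite -hactD !subrr hact0. Qed.

Definition coboundary1 (c : {ffun H -> A}) : {ffun H * H -> A} :=
  [ffun x => M x.1 (c x.2) - c (x.1 * x.2)%g + c x.1].

Definition cocycle2 : {pred {ffun H * H -> A}} :=
  [pred f : {ffun H * H -> A} | [forall h : H, forall k : H, forall l : H,
     M h (f (k, l)) - f (h * k, l)%g + f (h, k * l)%g - f (h, k) == 0]].

Lemma cocycle2P (f : {ffun H * H -> A}) :
  reflect (forall h k l,
    M h (f (k, l)) - f (h * k, l)%g + f (h, k * l)%g - f (h, k) = 0)
  (f \in cocycle2).
Proof.
apply: (iffP idP) => [+ h k l|hf].
  by move=> /forallP /(_ h) /forallP /(_ k) /forallP /(_ l) /eqP.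
by apply/forallP => h; apply/forallP => k; apply/forallP => l; apply/eqP.
Qed.

Fact cocycle2_zmod_closed : zmod_closed cocycle2.
Proof.
split=> [|f g /cocycle2P hf /cocycle2P hg]; apply/cocycle2P => h k l.
  by rewrite !ffunE hact0 subrr addr0 subrr.
rewrite !ffunE hactD hactN !opprD.
rewrite (addrACA (M h (f _))) (addrACA (M h (f _) - _)).
rewrite (addrACA (M h (f _) - _ + _)) -!opprD.
by rewrite hf hg subrr.
Qed.

HB.instance Definition _ :=
  GRing.isZmodClosed.Build {ffun H * H -> A} cocycle2 cocycle2_zmod_closed.

Record Z2 := Cocycle2 { z2val :> {ffun H * H -> A}; _ : z2val \in cocycle2 }.
HB.instance Definition _ := [isSub for z2val].
HB.instance Definition _ := [Choice of Z2 by <:].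
HB.instance Definition _ := [SubChoice_isSubZmodule of Z2 by <:].

Definition B2 : {pred Z2} :=
  [pred f : Z2 | `[< exists c, val f = coboundary1 c >]].

Fact B2_zmod_closed : zmod_closed B2.
Proof.
split=> [|f g /asboolP [c hc] /asboolP [e he]]; apply/asboolP.
  by exists 0; apply/ffunP => x; rewrite !ffunE hact0 subrr addr0.
exists (c - e); apply/ffunP => x.
rewrite raddfB /= hc he !ffunE hactD hactN !opprD.
by rewrite (addrACA (M x.1 (c _))) (addrACA (M x.1 (c _) - _)).
Qed.

HB.instance Definition _ := GRing.isZmodClosed.Build Z2 B2 B2_zmod_closed.

Definition H2 : zmodType := Quotient.quot B2.
Definition H2_class (f : Z2) : H2 := \pi_((Quotient.quot B2)) f.

End Cohomology.

Section Functoriality.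
Variables (H : finGroupType) (A : zmodType) (M : hmodule H A).

Definition equivariant (g : A -> A) : Prop :=
  forall h a, g (M h a) = M h (g a).

Variables (g : {additive A -> A}) (gM : equivariant g).

Fact Z2_map_subproof (f : Z2 M) : [ffun x => g (f x)] \in cocycle2 M.
Proof.
have /cocycle2P hf := valP f; apply/cocycle2P => h k l.
by rewrite !ffunE -gM -raddfB -raddfD -raddfB hf raddf0.
Qed.

Definition Z2_map (f : Z2 M) : Z2 M := Cocycle2 (Z2_map_subproof f).

(* Well defined on cohomology classes by [H2_map_class].                      *)
Definition H2_map (z : H2 M) : H2 M := H2_class (Z2_map (repr z)).

Lemma H2_classP (f f' : Z2 M) :
  H2_class f = H2_class f' <->
  exists c : {ffun H -> A}, val f - val f' = coboundary1 M c.
Proof.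
split; first by move=> /eqquotP /asboolP [c hc]; exists c; rewrite -hc raddfB.
by move=> [c hc]; apply/eqquotP/asboolP; exists c; rewrite raddfB.
Qed.

Lemma H2_map_class f : H2_map (H2_class f) = H2_class (Z2_map f).
Proof.
have : H2_class (repr (H2_class f)) = H2_class f by exact: reprK.
move=> /H2_classP [c hc]; apply/H2_classP; exists [ffun h => g (c h)].
apply/ffunP => x; have := congr1 (fun F : {ffun _ -> _} => g (F x)) hc.
by rewrite /= !ffunE !raddfD !raddfN /= gM.
Qed.

End Functoriality.

(* A group extension 1 -> A -> E -> H -> 1 with abelian kernel [A].           *)
Record extension (A : zmodType) (E : groupType) (H : finGroupType) := Extension {
  ext_inj : A -> E;
  ext_proj : E -> H;
  ext_injD : {morph ext_inj : a b / a + b >-> (a * b)%g};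
  ext_inj_injective : injective ext_inj;
  ext_projM : {morph ext_proj : u v / (u * v)%g};
  ext_proj_surj : forall h, exists e, ext_proj e = h;
  ext_exact : forall e, ext_proj e = 1%g <-> exists a, ext_inj a = e
}.

Section ExtensionClass.
Variables (A : zmodType) (E : groupType) (H : finGroupType).
Variable X : extension A E H.

Local Notation i := (ext_inj X).
Local Notation q := (ext_proj X).

Lemma ext_proj1 : q 1%g = 1%g.
Proof. by apply: (mulgI (q 1%g)); rewrite -ext_projM !mulg1. Qed.

Lemma ext_projV e : q e^-1%g = (q e)^-1%g.
Proof. by apply: (mulgI (q e)); rewrite -ext_projM !mulgV ext_proj1. Qed.

Lemma ext_inj0 : i 0 = 1%g.
Proof. by apply: (mulgI (i 0)); rewrite -ext_injD addr0 mulg1. Qed.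

Lemma ext_injN a : i (- a) = (i a)^-1%g.
Proof. by apply: (mulgI (i a)); rewrite -ext_injD subrr mulgV ext_inj0. Qed.

Lemma ext_proj_inj a : q (i a) = 1%g.
Proof. by apply/ext_exact; exists a. Qed.

Definition ext_section (h : H) : E := sval (cid (ext_proj_surj X h)).

Lemma ext_sectionK : cancel ext_section q.
Proof. by move=> h; rewrite /ext_section; case: cid. Qed.

Definition ext_retract (e : E) (qe : q e = 1%g) : A :=
  sval (cid ((ext_exact X e).1 qe)).

Lemma ext_retractK e (qe : q e = 1%g) : i (ext_retract qe) = e.
Proof. by rewrite /ext_retract; case: cid. Qed.

Fact ext_conj_subproof (e : E) (a : A) : q (e * i a * e^-1)%g = 1%g.
Proof. by rewrite !ext_projM ext_projV ext_proj_inj mulg1 mulgV. Qed.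

(* The left action of [H] on [A] by conjugation in [E]: [h] acts as           *)
(* a |-> e a e^-1 for any lift [e] of [h], see [ext_actE].                    *)
Definition ext_act (h : H) (a : A) : A :=
  ext_retract (ext_conj_subproof (ext_section h) a).

Lemma ext_actE e a : i (ext_act (q e) a) = (e * i a * e^-1)%g.
Proof.
rewrite /ext_act ext_retractK; set s := ext_section _.
have [b be] : exists b, i b = (s^-1 * e)%g.
  by apply/ext_exact; rewrite ext_projM ext_projV ext_sectionK mulVg.
have -> : e = (s * i b)%g by rewrite be mulgA mulgV mul1g.
rewrite invgM !mulgA; congr (_ * _)%g; rewrite -!mulgA; congr (_ * _)%g.
by rewrite -ext_injN -!ext_injD addrCA subrr addr0.
Qed.

Fact ext_act1 a : ext_act 1%g a = a.
Proof.
apply: (@ext_inj_injective _ _ _ X).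
by rewrite -ext_proj1 ext_actE mul1g invg1 mulg1.
Qed.

Fact ext_actM h k a : ext_act (h * k)%g a = ext_act h (ext_act k a).
Proof.
apply: (@ext_inj_injective _ _ _ X).
have [e <-] := ext_proj_surj X h; have [u <-] := ext_proj_surj X k.
by rewrite -ext_projM !ext_actE invgM !mulgA.
Qed.

Fact ext_actD h : {morph ext_act h : a b / a + b}.
Proof.
move=> a b; apply: (@ext_inj_injective _ _ _ X).
have [e <-] := ext_proj_surj X h.
by rewrite ext_injD !ext_actE ext_injD !mulgA mulgVK.
Qed.

Definition ext_module : hmodule H A := HModule ext_act1 ext_actM ext_actD.

(* A factor set: section(h) section(k) = f(h, k) section(hk).                 *)
Definition factor_set (s : H -> E) (f : H * H -> A) : Prop :=
  cancel s q /\ forall h k, (s h * s k = i (f (h, k)) * s (h * k))%g.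

Fact factor_set_cocycle s (f : {ffun H * H -> A}) :
  factor_set s f -> f \in cocycle2 ext_module.
Proof.
move=> [qs hf]; apply/cocycle2P => h k l; apply/eqP.
rewrite subr_eq add0r addrAC subr_eq; apply/eqP.
apply: (@ext_inj_injective _ _ _ X); rewrite !ext_injD /= -{1}(qs h) ext_actE.
apply: (mulIg (s (h * (k * l)))%g).
rewrite -[RHS]mulgA [in RHS](mulgA h k l) -(hf (h * k)%g l).
rewrite [RHS]mulgA -(hf h k).
by rewrite -!mulgA -(hf h (k * l)%g) mulKg (hf k l).
Qed.

Fact ext_cochain_subproof h k :
  q (ext_section h * ext_section k * (ext_section (h * k))^-1)%g = 1%g.
Proof. by rewrite !ext_projM ext_projV !ext_sectionK mulgV. Qed.

Definition ext_cochain : {ffun H * H -> A} :=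
  [ffun x => ext_retract
    (ext_cochain_subproof x.1 x.2)].

Lemma ext_factor_set : factor_set ext_section ext_cochain.
Proof.
split=> [|h k]; first exact: ext_sectionK.
by rewrite ffunE ext_retractK mulgVK.
Qed.

Definition ext_cocycle : Z2 ext_module :=
  Cocycle2 (factor_set_cocycle ext_factor_set).

(* The class of any factor set of the extension, see [ext_classE].            *)
Definition ext_class : H2 ext_module := H2_class ext_cocycle.

Lemma ext_classE s (f : {ffun H * H -> A}) (sf : factor_set s f) :
  ext_class = H2_class (Cocycle2 (factor_set_cocycle sf)).
Proof.
apply/H2_classP => /=.
have [qs hf] := sf; have [qt hg] := ext_factor_set.
set t := ext_section in qt hg; set g := ext_cochain in hg *.
have ct h : q (t h * (s h)^-1)%g = 1%g by rewrite ext_projM ext_projV qs qt mulgV.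
pose c := [ffun h => ext_retract (ct h)].
have tc h : t h = (i (c h) * s h)%g by rewrite ffunE ext_retractK mulgVK.
exists c; apply/ffunP => -[h k]; rewrite 3!ffunE [RHS]ffunE /=.
apply/eqP; rewrite subr_eq; apply/eqP.
apply: (@ext_inj_injective _ _ _ X).
apply: (mulIg (t (h * k)%g)); rewrite ext_retractK mulgVK -/t.
rewrite (tc (h * k)%g) mulgA -ext_injD.
have swap x y z w : x - y + z + w + y = z + x + w :> A.
  by rewrite addrAC (addrAC _ z) subrK (addrC x).
rewrite swap.
rewrite ext_injD -[RHS]mulgA -hf (tc h) (tc k) ext_injD.
have ae a : i (ext_act h a) = (s h * i a * (s h)^-1)%g.
  by rewrite -{1}(qs h) ext_actE.
by rewrite ae !mulgA mulgVK.
Qed.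

End ExtensionClass.

(* Continuous automorphisms. For a compact Hausdorff group the inverse is     *)
(* automatically continuous, hence not required to be so.                     *)
Record group_aut (G : topologicalGroupType) := GroupAut {
  gaut_fun :> G -> G;
  gautM : {morph gaut_fun : x y / (x * y)%g};
  gaut_bij : bijective gaut_fun;
  gaut_continuous : continuous gaut_fun
}.

Record GL (A : topologicalZmodType) := ZmodAut {
  zaut_fun :> {additive A -> A};
  zaut_bij : bijective zaut_fun;
  zaut_continuous : continuous zaut_fun
}.

Section FixingExtensionClass.
Variables (A : topologicalZmodType) (E : groupType) (H : finGroupType).
Variable X : extension A E H.

Definition AutH : set (GL A) := [set g | equivariant (ext_module X) g].

Definition AutH_beta : set (GL A) :=
  [set g | exists gH : AutH g, H2_map gH (ext_class X) = ext_class X].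

End FixingExtensionClass.

Section Induced.
Variables (F : topologicalGroupType) (H : finGroupType).
Variables (pi : {multiplicative F -> H}) (I : normalSubgroup F).
Hypothesis pi_surj : forall h, exists x, pi x = h.
Hypothesis comm_sub : closed_commutator (kernel pi) `<=` I.
Hypothesis sub_ker : I `<=` kernel pi.

Local Notation R := (kernel pi).
Local Notation p := (@pcoset F I).

Lemma pi1 : pi 1%g = 1%g.
Proof. by apply: (mulgI (pi 1%g)); rewrite -gmulfM !mulg1. Qed.

Lemma piV x : pi x^-1%g = (pi x)^-1%g.
Proof. by apply: (mulgI (pi x)); rewrite -gmulfM !mulgV pi1. Qed.

Fact image_kernel_subgroup : subgroup (p @` R).
Proof.
split; first by exists 1%g => //; exact: pi1.
move=> _ _ [x Rx <-] [y Ry <-]; exists (x * y^-1)%g.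
  by rewrite /kernel /= gmulfM piV Rx Ry invg1 mulg1.
by rewrite pcosetM pcosetV.
Qed.

Fact image_kernel_commute x y : (p @` R) x -> (p @` R) y -> commute x y.
Proof.
move=> [u Ru <-] [v Rv <-]; rewrite /commute -!pcosetM.
apply/esym/pcosetP; rewrite invgM -mulgA.
suff -> : (u^-1 * (v^-1 * (u * v)) = [~ u, v])%g.
  apply: comm_sub; apply: subset_closure; apply: sub_gen_smallest.
  by exists u, v.
by rewrite commgEl conjgE.
Qed.

(* R / I, the group of the cosets of I in F that are contained in R = ker pi. *)
Definition Rtilde : topologicalZmodType :=
  abelian_subgroup image_kernel_subgroup image_kernel_commute.

Definition Rtilde_class (x : F) (Rx : R x) : Rtilde :=
  asub_mk image_kernel_subgroup image_kernel_commute
    (ex_intro2 _ _ x Rx erefl).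

Definition Rtilde_inj : Rtilde -> coset_type I := @asub_val _ _ _ _.

Definition quotient_proj (z : coset_type I) : H := pi (repr z).

Lemma quotient_projE x : quotient_proj (p x) = pi x.
Proof.
have /pcosetP/sub_ker := pcoset_repr (p x).
rewrite /kernel /= gmulfM piV => h; rewrite /quotient_proj.
by apply: (mulgI (pi (repr (p x)))^-1%g); rewrite mulVg h.
Qed.

Fact quotient_projM : {morph quotient_proj : u v / (u * v)%g}.
Proof.
move=> u v; have [x <-] := pcoset_surj u; have [y <-] := pcoset_surj v.
by rewrite -pcosetM !quotient_projE gmulfM.
Qed.

Fact quotient_proj_surj h : exists e, quotient_proj e = h.
Proof. by have [x <-] := pi_surj h; exists (p x); rewrite quotient_projE. Qed.

Fact Rtilde_exact e : quotient_proj e = 1%g <-> exists a, Rtilde_inj a = e.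
Proof.
split=> [|[a <-]].
  have [x <-] := pcoset_surj e; rewrite quotient_projE => Rx.
  by exists (Rtilde_class Rx).
by have [x Rx] := asub_valP a; rewrite /Rtilde_inj => <-; rewrite quotient_projE.
Qed.

(* 1 -> R / I -> F / I -> H -> 1 *)
Definition quotient_extension : extension Rtilde (coset_type I) H :=
  @Extension Rtilde (coset_type I) H Rtilde_inj quotient_proj
    (@asub_valD _ _ _ _) (@asub_val_inj _ _ _ _)
    quotient_projM quotient_proj_surj Rtilde_exact.

Definition A_pi_I : set (group_aut F) :=
  [set a : group_aut F | pi \o a = pi /\ a @` I = I].

Section Action.
Variable a : A_pi_I.

Local Notation alpha := (set_val a : group_aut F).

Lemma A_pi_IE x : pi (alpha x) = pi x.
Proof. by have [h _] := set_valP a; rewrite -[RHS](congr1 (@^~ x) h). Qed.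

Lemma A_pi_IP x : nsub_set I (alpha x) <-> nsub_set I x.
Proof.
have [_ h] := set_valP a; split=> [|Ix]; last by rewrite -h; exists x.
by rewrite -{1}h => -[y Iy] /(bij_inj (gaut_bij alpha)) <-.
Qed.

Lemma alphaV x : alpha x^-1%g = (alpha x)^-1%g.
Proof.
have a1 : alpha 1%g = 1%g.
  by apply: (mulgI (alpha 1%g)); rewrite -gautM !mulg1.
by apply: (mulgI (alpha x)); rewrite -gautM !mulgV a1.
Qed.

Definition coset_map (z : coset_type I) : coset_type I := p (alpha (repr z)).

Lemma coset_mapE x : coset_map (p x) = p (alpha x).
Proof.
apply/pcosetP; rewrite -alphaV -gautM; apply/A_pi_IP/pcosetP.
exact: pcoset_repr.
Qed.

Lemma coset_map_continuous : continuous coset_map.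
Proof.
apply/coset_continuous.
have -> : coset_map \o p = p \o alpha by apply/funext => x; exact: coset_mapE.
move=> x; apply: continuous_comp; first exact: gaut_continuous.
exact: pcoset_continuous.
Qed.

Fact rho_subproof (z : Rtilde) : (p @` R) (coset_map (Rtilde_inj z)).
Proof.
have [x Rx] := asub_valP z; rewrite /Rtilde_inj => <-; rewrite coset_mapE.
by exists (alpha x) => //; rewrite /kernel /= A_pi_IE.
Qed.

Definition rho_fun (z : Rtilde) : Rtilde :=
  asub_mk image_kernel_subgroup image_kernel_commute (rho_subproof z).

Lemma rho_funE x (Rx : R x) (Rax : R (alpha x)) :
  rho_fun (Rtilde_class Rx) = Rtilde_class Rax.
Proof. by apply: asub_val_inj; exact: coset_mapE. Qed.

Lemma Rtilde_classP (z : Rtilde) : exists x (Rx : R x), z = Rtilde_class Rx.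
Proof.
have [x Rx xz] := asub_valP z; exists x, Rx.
by apply: asub_val_inj; rewrite -xz.
Qed.

Lemma Rtilde_class_eq x y (Rx : R x) (Ry : R y) :
  Rtilde_class Rx = Rtilde_class Ry <-> nsub_set I (x^-1 * y)%g.
Proof.
rewrite -pcosetP; split=> [/(congr1 Rtilde_inj)//|h].
exact: asub_val_inj.
Qed.

Fact rho_fun_additive : zmod_morphism rho_fun.
Proof.
move=> u v; apply: asub_val_inj; rewrite /= asub_valD asub_valN /=.
have [x [Rx ->]] := Rtilde_classP u; have [y [Ry ->]] := Rtilde_classP v.
change (coset_map (p x * (p y)^-1)%g =
  coset_map (p x) * (coset_map (p y))^-1)%g.
by rewrite -pcosetV -pcosetM !coset_mapE gautM alphaV pcosetM pcosetV.
Qed.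

HB.instance Definition _ :=
  GRing.isZmodMorphism.Build Rtilde Rtilde rho_fun rho_fun_additive.

Fact rho_fun_bij : bijective rho_fun.
Proof.
have A_R x : R (alpha x) <-> R x by rewrite /kernel /= A_pi_IE.
have rho_inj : injective rho_fun.
  move=> u v.
  have [x [Rx ->]] := Rtilde_classP u; have [y [Ry ->]] := Rtilde_classP v.
  rewrite (rho_funE Rx ((A_R x).2 Rx)) (rho_funE Ry ((A_R y).2 Ry)).
  move=> /Rtilde_class_eq; rewrite -alphaV -gautM => /A_pi_IP h.
  exact/Rtilde_class_eq.
have rho_surj v : exists u, rho_fun u = v.
  have [y [Ry ->]] := Rtilde_classP v.
  have [b _ bK] := gaut_bij alpha.
  have Rby : R (b y) by apply/A_R; rewrite bK.
  exists (Rtilde_class Rby); rewrite (rho_funE Rby ((A_R _).2 Rby)).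
  by apply/Rtilde_class_eq; rewrite bK mulVg; exact: (nsub_subgroup I).1.
exists (fun v => sval (cid (rho_surj v))) => v; last by case: cid.
by apply: rho_inj; case: cid.
Qed.

Fact rho_fun_continuous : continuous rho_fun.
Proof.
apply: asub_continuous => z.
apply: (@continuous_comp _ _ _ Rtilde_inj coset_map).
  exact: asub_val_continuous.
exact: coset_map_continuous.
Qed.

(* The action of [a] on R / I, see [rho_funE].                                *)
Definition rho : GL Rtilde := ZmodAut rho_fun_bij rho_fun_continuous.

End Action.

End Induced.

(* Main.v *)
(* Lifts of an automorphism g of R / I. The cocycle identity behind           *)
(* g_* beta = beta is exactly what makes                                      *)
(*   i(a) s(h) |-> i(g a + c(h)) s(h)                                         *)
(* an automorphism phi of F / I that extends g and induces the identity on H, *)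
(* so it remains to lift phi to F. Gaschutz's lemma in the finite quotients   *)
(* of F, together with compactness, lifts the generators phi(x_i I) of F / I  *)
(* to topological generators y_i of F. The endomorphism x_i |-> y_i of F is   *)
(* then onto, and it is one-to-one because F, being finitely generated, is    *)
(* Hopfian. It agrees with phi modulo I since it does so on the basis.        *)

(* The inclusion from left to right is formal. The map induced by alpha on F / I extends rho(alpha)
   and covers the identity of H; it carries sections to sections, so rho(alpha) fixes beta
   ([extends_to_AutH_beta]).

   For the converse, [AutH_beta_extends_to] extends g to an endomorphism phi of F / I over H, which
   is bijective by the five lemma and continuous because R / I is open in F / I. The substance is
   [free_profinite_lift_aut]: for N closed, every continuous automorphism of F / N lifts to F. It
   rests on a count in finite groups: the number of generating lifts to G of a generating tuple of G
   / N is the same for all tuples of a given length, so if one tuple has such a lift, all have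
   ([gaschutz]). Compactness carries this over to F ([gaschutz_profinite]), and [generates_aut]
   turns topological generators into an automorphism. *)
Require Import Defs.
From HB Require Import structures.
From mathcomp Require Import fingroup perm morphism quotient gproduct.
From mathcomp Require Import all_boot all_order all_algebra.

Set Implicit Arguments.
Unset Strict Implicit.
Unset Printing Implicit Defensive.

(** * Gaschutz's lemma for finite groups *)

Section FiniteGaschutz.
Local Open Scope group_scope.
Variables (I : finType) (gT : finGroupType).
Implicit Types (a b t : {ffun I -> gT}) (G N L K : {group gT}).

Definition generated_by t : {group gT} := <<[set t i | i : I]>>%G.
Arguments generated_by : simpl never.

Lemma generated_by_sub t K :
  (generated_by t \subset K) = [forall i, t i \in K].
Proof.
rewrite gen_subG; apply/subsetP/forallP => [h i|h _ /imsetP[i _ ->]//].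
by apply: h; exact: imset_f.
Qed.

Lemma mem_generated_by t i : t i \in generated_by t.
Proof. by apply: mem_gen; exact: imset_f. Qed.

Definition coset_tuples N a : {set {ffun I -> gT}} :=
  [set t : {ffun I -> gT} | [forall i, t i \in a i *: N]].

(** Each coset of N involved meets L, and the intersection is a coset of [L :&: N]. The count
    therefore does not depend on [a]. *)
Lemma card_coset_tuples_in N L a :
  (forall i, a i \in L * N) ->
  #|[set t in coset_tuples N a | generated_by t \subset L]| =
  (#|L :&: N| ^ #|I|)%N.
Proof.
move=> aLN.
have /fin_all_exists[c hc] i : exists c, c \in L :&: (a i *: N).
  have /mulsgP[l n lL nN e] := aLN i.
  by exists l; rewrite inE lL mem_lcoset e invMg mulgKV groupV.
rewrite -card_ffun_on.
pose f t : {ffun I -> gT} := [ffun i => c i * t i].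
have f_inj : injective f.
  move=> t u /ffunP h; apply/ffunP => i.
  by move: (h i); rewrite !ffunE => /mulgI.
rewrite -[RHS](card_imset _ f_inj); apply: eq_card => t.
rewrite inE [t \in coset_tuples _ _]inE generated_by_sub.
apply/idP/imsetP => [/andP[/forallP tN /forallP tL]|[u /ffun_onP hu ->]].
  exists [ffun i => (c i)^-1 * t i]; last first.
    by apply/ffunP => i; rewrite !ffunE mulKVg.
  apply/ffun_onP => i; rewrite ffunE !inE.
  have /setIP[cL] := hc i; rewrite mem_lcoset => cN.
  rewrite groupMl ?groupV // tL /=.
  have := tN i; rewrite mem_lcoset => tN'.
  by rewrite -(mulKVg (a i) (t i)) mulgA groupMl // -groupV invMg !invgK.
apply/andP; split; apply/forallP => i; rewrite ffunE; have := hu i;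
  have /setIP[cL] := hc i; rewrite ?mem_lcoset inE => cN /andP[uL uN].
  by rewrite mulgA groupM.
by rewrite groupM.
Qed.

(* P. Hall's counting: the lifts generating L are the lifts in L that do not  *)
(* generate a proper subgroup of L. There are |L :&: N| ^ |I| lifts in L, so  *)
(* induction on L applies.                                                    *)
Lemma card_generating_lifts G N L a b : G \subset 'N(N) ->
  G \subset generated_by a * N -> G \subset generated_by b * N ->
  generated_by a \subset G -> generated_by b \subset G ->
  N \subset G -> L \subset G -> G \subset L * N ->
  #|[set t in coset_tuples N a | generated_by t == L]| =
  #|[set t in coset_tuples N b | generated_by t == L]|.
Proof.
move=> nNG Ga Gb aG bG NG.
have [n] := ubnP #|L|; elim: n L => // n IHn L ltLn LG GLN.
pose S c := [set t in coset_tuples N c | generated_by t \subset L].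
have SE c : generated_by c \subset G -> #|S c| = (#|L :&: N| ^ #|I|)%N.
  move=> cG; apply: card_coset_tuples_in => i; apply: (subsetP GLN).
  by apply: (subsetP cG); exact: mem_generated_by.
have splitS c : #|S c| =
    (#|[set t in coset_tuples N c | generated_by t == L]| +
     \sum_(K : {group gT} | K \proper L)
       #|[set t in coset_tuples N c | generated_by t == K]|)%N.
  rewrite -sum1_card (partition_big generated_by (fun K => K \subset L)) /=;
    last by move=> t; rewrite inE => /andP[].
  rewrite (bigD1 L) //=; congr (_ + _)%N.
    rewrite -sum1_card; apply: eq_bigl => t; rewrite !inE.
by case: eqP => [->|_]; rewrite ?subxx ?andbT ?andbF.
  rewrite (eq_bigl (fun K : {group gT} => K \proper L)); last first.
    by move=> K; rewrite properEneq andbC.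
  apply: eq_bigr => K /proper_sub KL.
  rewrite -sum1_card; apply: eq_bigl => t; rewrite !inE.
  by case: eqP => [->|_]; rewrite ?KL ?andbT ?andbF.
(* A lift generating K forces K to supplement N in G. A subgroup K that does not supplement N thus
   contributes 0 for both tuples, and the induction only needs the others. *)
have tupN c K t : generated_by c \subset G -> G \subset generated_by c * N ->
    t \in [set t in coset_tuples N c | generated_by t == K] ->
    K \subset G -> G \subset K * N.
  move=> cG Gc; rewrite !inE => /andP[/forallP tc /eqP <-] tG.
  have nNt := subset_trans tG nNG.
  apply: (subset_trans Gc).
  rewrite -(norm_joinEl nNt) mul_subG ?joing_subr //.
  rewrite generated_by_sub; apply/forallP => i.
  have := tc i; rewrite mem_lcoset => h.
  rewrite -[c i]invgK -(mulgK (t i) (c i)^-1) invMg invgK -groupV invMg invgK.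
  rewrite groupM //; first exact: (subsetP (joing_subr _ _)).
  by rewrite groupV (subsetP (joing_subl _ _)) // mem_generated_by.
apply/eqP; rewrite -(eqn_add2r (\sum_(K : {group gT} | K \proper L)
       #|[set t in coset_tuples N a | generated_by t == K]|)) -splitS (SE a) //.
rewrite -(SE b) // splitS; apply/eqP; congr (_ + _)%N.
apply: eq_bigr => K KL.
have KG : K \subset G := subset_trans (proper_sub KL) LG.
have [GKN|GKN] := boolP (G \subset K * N).
  apply/esym/IHn => //; exact: leq_trans (proper_card KL) _.
transitivity 0%N; [|symmetry]; apply/eqP; rewrite cards_eq0 -subset0;
  apply/subsetP => t tK.
  by case/negP: GKN; apply: (tupN b _ t).
by case/negP: GKN; apply: (tupN a _ t).
Qed.

(** The number of lifts generating all of G is the same for [a] and for [b]; it is positive for [a],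
    which is a generating lift of itself. *)
Theorem gaschutz G N a b : generated_by a = G -> N <| G ->
  generated_by b \subset G -> G \subset generated_by b * N ->
  exists2 t : {ffun I -> gT}, (forall i, t i \in b i *: N) & generated_by t = G.
Proof.
move=> aG /andP[NG nNG] bG Gb.
have Ga : G \subset generated_by a * N by rewrite aG mulG_subl.
have GG : G \subset G * N by exact: mulG_subl.
have aG' : generated_by a \subset G by rewrite aG.
have := card_generating_lifts nNG Ga Gb aG' bG NG (subxx G) GG.
move=> h; have : (0 < #|[set t in coset_tuples N b | generated_by t == G]|)%N.
  rewrite -h card_gt0; apply/set0Pn; exists a; rewrite !inE aG eqxx andbT.
  by apply/forallP => i; exact: lcoset_refl.
rewrite card_gt0 => /set0Pn[t]; rewrite !inE => /andP[/forallP tb /eqP tG].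
by exists t.
Qed.
End FiniteGaschutz.

From mathcomp Require Import finmap all_classical topology tvs.

Import GRing.Theory.

Local Open Scope classical_set_scope.

(** * Finite quotients of profinite groups *)

(** In a compact Hausdorff space quasi-components are connected. Total disconnectedness then reduces
    them to points, so clopen sets separate points. *)
Lemma compact_totally_disconnected_zero_dimensional (T : topologicalType) :
  compact [set: T] -> hausdorff_space T -> totally_disconnected [set: T] ->
  zero_dimensional T.
Proof.
move=> cT hT tdT x y xy.
apply: contrapT => nU.
pose Q := [set z | forall U : set T, clopen U -> U x -> U z].
have clQ : closed Q.
  have -> : Q = \bigcap_(U in [set U : set T | clopen U /\ U x]) U.
    by apply/seteqP; split=> z h U; [case; exact: h|move=> cU Ux; exact: (h U)].
  by apply: closed_bigI => U [[]].
have Qy : Q y.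
  by move=> U cU Ux; apply: contrapT => Uy; apply: nU; exists U.
have Qx : Q x by [].
suff cQ : connected Q.
  have : [set x] y.
    by rewrite -(tdT x) //; exact: (connected_component_max Qx _ cQ).
  by move=> /= e; rewrite e eqxx in xy.
have nT : normal_space T by exact: compact_normal.
(* Q is the quasi-component of x. By normality and compactness a splitting   *)
(* of Q into closed sets A and B extends to a clopen set containing A only.  *)
have key A B : closed A -> closed B -> A `&` B = set0 -> A `|` B = Q ->
    A x -> B = set0.
  move=> clA clB AB0 ABQ Ax.
  have nbhsA : set_nbhs A (~` B).
    apply/set_nbhsP; exists (~` B); split=> //; first exact: closed_openC.
    by move=> z Az Bz; have : (A `&` B) z by []; rewrite AB0.
  have [V] := nT A clA _ nbhsA.
  move=> /set_nbhsP[U [oU AU UV]] clVB.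
  pose W := U `|` ~` closure V.
  have QW : Q `<=` W.
    rewrite -ABQ => z [/AU|Bz]; first by left.
    by right=> /clVB.
  have oW : open W.
    by apply: openU => //; apply: closed_openC; exact: closed_closure.
  (* Every point off W is excluded by some clopen neighbourhood of x. These neighbourhoods are
     stable under intersection, so by compactness of the complement of W a single one excludes all
     such points. *)
  have [C [[oC cC] Cx CW]] : exists C : set T, [/\ clopen C, C x & C `<=` W].
    have cW : compact (~` W).
      by apply: (subclosed_compact _ cT) => //; exact: open_closedC.
    pose F := filter_from [set D : set T | clopen D /\ D x]
      (fun D => [set E : set T | E `<=` D]).
    have FF : Filter F.
      apply: filter_from_filter.
        by exists setT; split=> //; exact: clopenT.
      move=> D E [cD Dx] [cE Ex]; exists (D `&` E).
        by split=> //; exact: clopenI.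
      by move=> K KDE; split=> z /KDE [].
    have [|D [cD Dx] /(_ D) DW] := (compact_near_coveringP _).1 cW _ F
      (fun E z => ~ E z) FF.
      move=> z Wz; have : ~ Q z by move/QW.
      move=> /existsNP[D /not_implyP[cD /not_implyP[Dx Dz]]].
      exists (~` D, [set E : set T | E `<=` D]); last first.
        by move=> [u E] [/= Du ED] /ED.
      split; last by exists D.
      by apply: open_nbhs_nbhs; split=> //; apply: closed_openC; case: cD.
    exists D; split=> // z Dz; apply: contrapT => Wz.
    by apply: (DW _ z Wz Dz) => ?.
  (* C meets [closure V] only inside U, so cutting C with the open U or with the closed [closure V]
     gives the same set. *)
  have clUC : clopen (C `&` U).
    split; first exact: openI.
    have -> : C `&` U = C `&` closure V.
      apply/seteqP; split=> z [Cz Vz]; split=> //.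
        by apply: subset_closure; exact: UV.
      by have [//|] := CW z Cz.
    by apply: closedI => //; exact: closed_closure.
  apply/seteqP; split=> // z Bz.
  have Qz : Q z by rewrite -ABQ; right.
  have [_ Uz] := Qz _ clUC (conj Cx (AU _ Ax)).
  have /clVB : closure V z by apply: subset_closure; exact: UV.
  by apply.
move=> B [z Bz] [C oC BC] [D cD BD].
have clB : closed B by rewrite BD; exact: closedI.
have clQB : closed (Q `\` B).
  have -> : Q `\` B = Q `&` ~` C.
    rewrite BC; apply/seteqP; split=> u [Qu h]; split=> //.
      by move=> Cu; apply: h.
    by case.
  by apply: closedI => //; exact: open_closedC.
have BQ : B `<=` Q by rewrite BC; exact: subIsetl.
have disj : B `&` (Q `\` B) = set0 by rewrite setIDA setIC -setIDA setDv setI0.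
have un : B `|` (Q `\` B) = Q by exact: setDUK.
have [Bx|nBx] := pselect (B x).
  by rewrite -un (key _ _ clB clQB disj un Bx) setU0.
have h : B = set0.
  by apply: (key (Q `\` B) B) => //; [rewrite setIC|rewrite setUC].
by rewrite h in Bz.
Qed.

Definition discrete_group (G : finGroupType) : Type := discrete_topology G.
HB.instance Definition _ (G : finGroupType) :=
  DiscreteTopology.on (discrete_group G).
HB.instance Definition _ (G : finGroupType) :=
  monoid.Group.copy (discrete_group G) G.

Lemma discrete_continuous (T : discreteTopologicalType) (U : topologicalType)
  (f : T -> U) : continuous f.
Proof.
move=> x A /= /nbhs_singleton Ax; rewrite /= nbhs_principalE.
exact/principal_filterP.
Qed.

Section DiscreteGroup.
Variable G : finGroupType.

Fact discrete_mulg_continuous :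
  continuous (fun z : discrete_group G * discrete_group G => (z.1 * z.2)%g).
Proof.
move=> [x y] A /= /nbhs_singleton Axy.
exists ([set x], [set y]) => /=; first by split; exact: discrete_set1.
by move=> [u v] /= [-> ->].
Qed.

Fact discrete_invg_continuous : continuous (fun z : discrete_group G => z^-1%g).
Proof. exact: discrete_continuous. Qed.
HB.instance Definition _ := isTopologicalGroup.Build (discrete_group G)
  discrete_mulg_continuous discrete_invg_continuous.

Lemma discrete_group_profinite : profinite (discrete_group G).
Proof.
split.
- by apply: finite_compact; exact: (@finite_finset G).
- exact: discrete_hausdorff.
- apply: zero_dimension_totally_disconnected; exact: discrete_zero_dimension.
Qed.

End DiscreteGroup.

(* [f] need not be onto: it stands for the quotient by its open kernel.       *)
Definition finite_quotient (F : topologicalGroupType) (G : finGroupType)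
    (f : F -> G) : Prop :=
  {morph f : u v / (u * v)%g} /\ forall u, \forall v \near u, f v = f u.

Lemma finite_quotient_continuous (F : topologicalGroupType) (G : finGroupType)
    (f : F -> discrete_group G) :
  continuous f <-> forall u, \forall v \near u, f v = f u.
Proof.
have h u := @discrete_cvg (discrete_group G) (f @ u) (f u) _.
by split=> cf u; [have /h := cf u|apply/h; exact: cf].
Qed.

Lemma cvgMg (G : topologicalGroupType) (T : Type) (FF : set_system T)
    (FFF : Filter FF) (f g : T -> G) (a b : G) :
  f @ FF --> a -> g @ FF --> b -> (fun z => (f z * g z)%g) @ FF --> (a * b)%g.
Proof.
move=> fa gb.
apply: (cvg_comp (fun z => (f z, g z)) (fun z : G * G => (z.1 * z.2)%g)).
  exact: cvg_pair fa gb.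
exact: (@mulg_continuous G (a, b)).
Qed.

Section Separation.
Variable F : topologicalGroupType.
Hypothesis profF : profinite F.

(** Locally one value suffices; the filter of large enough finite sets of values turns this, by
    compactness, into one finite set for all of F. *)
Lemma locally_constant_finite_range (T : Type) (s : F -> T) :
  (forall u, \forall v \near u, s v = s u) -> finite_set (range s).
Proof.
move=> ls; have [cF _ _] := profF.
pose Ft := filter_from (@finite_set T) (fun D => [set E : set T | D `<=` E]).
have FF : Filter Ft.
  apply: filter_from_filter; first by exists set0; exact: finite_set0.
  move=> D E fD fE; exists (D `|` E); first by rewrite finite_setU.
  by move=> K DEK; split=> z h; apply: DEK; [left|right].
have [|D fD /(_ D) h] :=
  (compact_near_coveringP _).1 cF _ Ft (fun E u => E (s u)) FF.
  move=> u _; exists ([set v | s v = s u], [set E : set T | [set s u] `<=` E]).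
    by split; [exact: ls|exists [set s u] => //; exact: finite_set1].
  by move=> [v E] [/= -> h]; exact: h.
apply: sub_finite_set fD => _ [u _ <-].
by apply: h.
Qed.

(** F permutes the translates of W, which are finitely many because translation is locally constant
    on them. An element acting trivially fixes W itself, so it lies in W as 1 does. *)
Lemma clopen_finite_quotient (W : set F) : clopen W -> W 1%g ->
  exists (G : finGroupType) (f : F -> G), finite_quotient f /\ kernel f `<=` W.
Proof.
move=> [oW cW] W1; have [cF _ _] := profF.
pose s u : set F := [set v | W (u * v)%g].
have lcW u : \forall v \near u, W v = W u.
  have [Wu|Wu] := pselect (W u).
    have : nbhs u W by apply: open_nbhs_nbhs.
    by apply: filterS => v Wv; apply/propext.
  have : nbhs u (~` W).
    by apply: open_nbhs_nbhs; split=> //; exact: closed_openC.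
  by apply: filterS => v Wv; apply/propext.
have lcM (T : Type) (FF : set_system T) (f g k : T -> F) (u a v : F) :
    Filter FF ->
    f @ FF --> u -> g @ FF --> a -> k @ FF --> v ->
    \forall z \near FF, W (f z * g z * k z)%g = W (f z * a * k z)%g.
  move=> FFF fu ga kv.
  have h3 := cvgMg FFF (cvgMg FFF fu ga) kv (lcW (u * a * v)%g).
  have ca : (fun=> a) @ FF --> a by exact: cvg_cst.
  have h4 := cvgMg FFF (cvgMg FFF fu ca) kv (lcW (u * a * v)%g).
  have h34 := @filterI _ FF FFF _ _ h3 h4.
  by apply: (@filterS _ FF FFF _ _ _ h34) => z [/= -> ->].
(* Compactness of F * F makes the neighbourhood of [a] uniform in u and v. *)
have lc a : \forall b \near a, forall u v, W (u * b * v)%g = W (u * a * v)%g.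
  have cFF : compact [set: F * F] by rewrite -setXTT; exact: compact_setX.
  have h : \forall b \near a, [set: F * F] `<=`
      (fun uv => W (uv.1 * b * uv.2)%g = W (uv.1 * a * uv.2)%g).
    apply: ((compact_near_coveringP _).1 cFF F (nbhs a) (fun b uv => _ = _)).
    move=> [u v] _ /=.
    have c1 : (fun z : (F * F) * F => z.1.1) @ ((u, v), a) --> u.
      by apply: (cvg_comp fst fst); exact: cvg_fst.
    have c2 : (fun z : (F * F) * F => z.1.2) @ ((u, v), a) --> v.
      by apply: (cvg_comp fst snd); [exact: cvg_fst|exact: cvg_snd].
    have c3 : (fun z : (F * F) * F => z.2) @ ((u, v), a) --> a.
      exact: cvg_snd.
    apply: lcM c1 c3 c2.
  by apply: filterS h => b h u v; exact: (h (u, v) I).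
have lcs a : \forall b \near a, s b = s a.
  apply: filterS (lc a) => b h; apply/funext => v; rewrite /s /=.
  by have := h 1%g v; rewrite !mul1g.
have := locally_constant_finite_range lcs; set S := range s => finS.
pose T := fset_set S.
have ST u : s u \in T by rewrite in_fset_set // inE; exists u.
pose act a (A : set F) : set F := [set v | A (a * v)%g].
have actE a u : act a (s u) = s (u * a)%g.
  by apply/funext => v; rewrite /act /s /= mulgA.
have actT a (t : T) : act a (val t) \in T.
  have := valP t; rewrite in_fset_set // inE => -[u _ <-].
  by rewrite actE.
pose p a (t : T) : T := FSetSub (actT a t).
(* This is a right action, in accordance with the left-to-right product of permutations. *)
have pM a b t : p (a * b)%g t = p b (p a t).
  by apply: val_inj; apply/funext => v; rewrite /= /act /= mulgA.
have p1 t : p 1%g t = t.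
  by apply: val_inj; apply/funext => v; rewrite /= /act /= mul1g.
have p_inj a : injective (p a).
  by apply: (can_inj (g := p a^-1%g)) => t; rewrite -pM mulgV p1.
exists {perm T}, (fun a => perm (p_inj a)); split; last first.
  move=> a /perm.permP /(_ (FSetSub (ST 1%g))).
  rewrite permE perm1 => /(congr1 val) /=.
  rewrite actE mul1g => /(congr1 (fun A : set F => A 1%g)).
  by rewrite /s /= !mulg1 => ->.
split=> [a b|a].
  by apply/perm.permP => t; rewrite permM !permE pM.
apply: filterS (lc a) => b h; apply/perm.permP => t; rewrite !permE.
apply: val_inj => /=; have := valP t; rewrite in_fset_set // inE => -[u _ <-].
by rewrite !actE; apply/funext => v; exact: h.
Qed.

Lemma nbhs1_finite_quotient (W : set F) : nbhs 1%g W ->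
  exists (G : finGroupType) (f : F -> G), finite_quotient f /\ kernel f `<=` W.
Proof.
have [cF hF tF] := profF.
have zF := compact_totally_disconnected_zero_dimensional cF hF tF.
move=> /(zero_dimensional_cvg hF zF cF)[D [D1 cD] DW].
have [G [f [qf fD]]] := clopen_finite_quotient cD D1.
by exists G, f; split=> // u /fD /DW.
Qed.

End Separation.

(** * Homomorphisms to finite groups and their images *)

Section Morphisms.
Variables (F G : groupType) (f : F -> G).
Hypothesis fM : {morph f : u v / (u * v)%g}.

Lemma morph_mul1 : f 1%g = 1%g.
Proof. by apply: (mulgI (f 1%g)); rewrite -fM !mulg1. Qed.

Lemma morph_mulV u : f u^-1%g = (f u)^-1%g.
Proof. by apply: (mulgI (f u)); rewrite -fM !mulgV morph_mul1. Qed.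

End Morphisms.

Section MorphicImage.
Variables (F : groupType) (G : finGroupType) (f : F -> G) (S : set F).
Hypotheses (fM : {morph f : u v / (u * v)%g}) (hS : subgroup S).

Definition finite_image : {set G} :=
  [set g : G | `[< exists2 u, S u & f u = g >]]%SET.

Lemma finite_imageP g : reflect (exists2 u, S u & f u = g) (g \in finite_image).
Proof. by rewrite inE; exact: asboolP. Qed.

Fact finite_image_group_set : group_set finite_image.
Proof.
apply/group_setP; split=> [|a b].
  by apply/finite_imageP; exists 1%g; [exact: hS.1|exact: morph_mul1].
move=> /finite_imageP[u Su <-] /finite_imageP[v Sv <-].
by apply/finite_imageP; exists (u * v)%g; rewrite ?fM //; exact: subgroupM.
Qed.

Definition finite_image_group : {group G} := group finite_image_group_set.

Lemma mem_finite_image u : S u -> f u \in finite_image_group.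
Proof. by move=> Su; apply/finite_imageP; exists u. Qed.

End MorphicImage.

Lemma subgroup_setT (F : groupType) : subgroup [set: F].
Proof. by []. Qed.

Lemma finite_image_norm (F : groupType) (G : finGroupType) (f : F -> G)
    (N : normalSubgroup F) (fM : {morph f : u v / (u * v)%g}) :
  (finite_image_group fM (subgroup_setT F) \subset
   'N(finite_image_group fM (nsub_subgroup N)))%g.
Proof.
apply/fintype.subsetP => _ /finite_imageP[u _ <-]; rewrite inE.
apply/fintype.subsetP => _ /imsetP[_ /finite_imageP[n Nn <-] ->].
apply/finite_imageP; exists (n ^ u)%g; first exact: nsub_conj.
by rewrite !conjgE !fM morph_mulV.
Qed.

Section FiniteQuotients.
Variables (F : topologicalGroupType).

Lemma finite_quotient_comp (E : topologicalGroupType) (G : finGroupType)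
    (f : E -> G) (a : F -> E) :
  finite_quotient f -> {morph a : u v / (u * v)%g} -> continuous a ->
  finite_quotient (f \o a).
Proof.
move=> [fM fc] aM ac; split=> [u v|u]; first by rewrite /= aM fM.
exact: (ac u _ (fc (a u))).
Qed.

Lemma finite_quotient_pair (G1 G2 : finGroupType) (f1 : F -> G1)
    (f2 : F -> G2) :
  finite_quotient f1 -> finite_quotient f2 ->
  finite_quotient (fun u => (f1 u, f2 u)).
Proof.
move=> [f1M f1c] [f2M f2c]; split=> [u v|u]; first by rewrite f1M f2M.
by apply: filterS (filterI (f1c u) (f2c u)) => v [-> ->].
Qed.

Lemma finite_quotient_cst (G : finGroupType) :
  finite_quotient (fun _ : F => 1%g : G).
Proof. by split=> [u v|u]; [rewrite mulg1|exact: nearW]. Qed.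

Lemma finite_quotient_morphism (G1 G2 : finGroupType) (f : F -> G1)
    (g : G1 -> G2) :
  finite_quotient f -> {in range f &, {morph g : u v / (u * v)%g}} ->
  finite_quotient (g \o f).
Proof.
move=> [fM fc] gM; split=> [u v|u]; last by apply: filterS (fc u) => v /= ->.
by rewrite /= fM gM //; apply/mem_set; [exists u|exists v].
Qed.

End FiniteQuotients.

(** If w is off the closed set N, so is w c for all c near 1, hence for all c in the kernel of some
    finite quotient f; then f w is not in f(N). *)
Lemma closed_separated (F : topologicalGroupType) (N : set F) w :
  profinite F -> closed N ->
  (forall (G : finGroupType) (f : F -> G), finite_quotient f ->
     exists2 n, N n & f n = f w) -> N w.
Proof.
move=> profF clN h; apply: contrapT => Nw.
have : nbhs 1%g [set c | ~ N (w * c)%g].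
  apply: (@mulgl_continuous F w 1%g (~` N)); rewrite mulg1.
  by apply: open_nbhs_nbhs; split=> //; exact: closed_openC.
move=> /(nbhs1_finite_quotient profF)[G [f [qf kf]]].
have [n Nn fn] := h G f qf; have [fM _] := qf.
have : kernel f (w^-1 * n)%g.
  by rewrite /kernel /= fM fn (morph_mulV fM) mulVg.
by move=> /kf; rewrite /= mulKVg.
Qed.

(** * Free profinite groups *)

Section Free.
Variables (d : nat) (F : topologicalGroupType) (x : 'I_d -> F).
Hypothesis F_free : free_profinite x.

Let profF : profinite F := F_free.1.

Lemma free_finite_quotient (G : finGroupType) (t : 'I_d -> G) :
  exists2 f : F -> G, finite_quotient f & forall i, f (x i) = t i.
Proof.
have [f [[cf fM fx] _]] :=
  F_free.2 (discrete_group G) t (discrete_group_profinite G).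
by exists f => //; split=> //; exact/finite_quotient_continuous.
Qed.

Lemma finite_quotient_eq (G : finGroupType) (f g : F -> G) :
  finite_quotient f -> finite_quotient g -> (forall i, f (x i) = g (x i)) ->
  f = g.
Proof.
move=> [fM fc] [gM gc] fg.
have [h [_ hU]] :=
  F_free.2 (discrete_group G) (f \o x) (discrete_group_profinite G).
transitivity h; [symmetry|]; apply: hU; split=> //.
- exact/finite_quotient_continuous.
- exact/finite_quotient_continuous.
- by move=> i; rewrite /= fg.
Qed.

(** By freeness some homomorphism into L has the values of f on the basis; by uniqueness it is f.
    This says that the basis generates F topologically. *)
Lemma finite_quotient_mem (G : finGroupType) (f : F -> G) (L : {group G}) :
  finite_quotient f -> (forall i, f (x i) \in L) -> forall u, f u \in L.
Proof.
move=> qf fL u.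
have [g qg gx] := free_finite_quotient (fun i => subg L (f (x i))).
suff -> : f = sgval \o g by exact: subgP.
apply: finite_quotient_eq => // [|i]; last by rewrite /= gx subgK.
by apply: finite_quotient_morphism => // a b _ _; exact: sgvalM.
Qed.

Definition tuple_image (G : finGroupType) (f : F -> G) (y : 'I_d -> F) :
  {ffun 'I_d -> G} := [ffun i => f (y i)].

Lemma generated_by_pair (G1 G2 : finGroupType) (f1 : F -> G1) (f2 : F -> G2)
    y g1 g2 :
  (g1, g2) \in generated_by (tuple_image (fun u => (f1 u, f2 u)) y) ->
  g1 \in generated_by (tuple_image f1 y) /\
  g2 \in generated_by (tuple_image f2 y).
Proof.
pose f u := (f1 u, f2 u).
have /fintype.subsetP sub : (generated_by (tuple_image f y) \subset
    setX_group (generated_by (tuple_image f1 y))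
      (generated_by (tuple_image f2 y)))%g.
  rewrite generated_by_sub; apply/fintype.forallP => i; rewrite ffunE inE /=.
  have := mem_generated_by (tuple_image f1 y) i.
  have := mem_generated_by (tuple_image f2 y) i.
  by rewrite !ffunE => -> ->.
by move=> /sub; rewrite inE => /andP[].
Qed.

Lemma finite_quotient_generated (G : finGroupType) (f : F -> G) u :
  finite_quotient f -> f u \in generated_by (tuple_image f x).
Proof.
move=> qf; apply: finite_quotient_mem => // i.
by have := mem_generated_by (tuple_image f x) i; rewrite ffunE.
Qed.

(* [y] generates [F] topologically, as seen in the finite quotients of [F].   *)
Definition generates (y : 'I_d -> F) := forall (G : finGroupType) (f : F -> G),
  finite_quotient f -> forall u, f u \in generated_by (tuple_image f y).

Definition generates_mod (N : set F) (y : 'I_d -> F) :=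
  forall (G : finGroupType) (f : F -> G), finite_quotient f ->
  forall u, exists2 n, N n & (f u * f n)%g \in generated_by (tuple_image f y).

(** Gaschutz's lemma in f(F) with normal subgroup f(N). The generating tuple of length d that it
    requires is the image of the basis. *)
Lemma gaschutz_finite_quotient (N : normalSubgroup F) (z : 'I_d -> F)
    (G : finGroupType) (f : F -> G) :
  generates_mod N z -> finite_quotient f ->
  exists2 y : 'I_d -> F, (forall i, nsub_set N ((z i)^-1 * y i)%g) &
    forall u, f u \in generated_by (tuple_image f y).
Proof.
move=> zN qf; have [fM fc] := qf.
pose I := finite_image_group fM (subgroup_setT F).
pose M := finite_image_group fM (nsub_subgroup N).
have fI u : f u \in I by exact: mem_finite_image.
have aI : generated_by (tuple_image f x) = I.
  apply/val_inj/eqP; rewrite finset.eqEsubset generated_by_sub.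
  apply/andP; split.
    by apply/fintype.forallP => i; rewrite ffunE.
  apply/fintype.subsetP => _ /finite_imageP[u _ <-].
  exact: finite_quotient_generated.
have MI : (M <| I)%g.
  by apply/andP; split; [apply/fintype.subsetP => _ /finite_imageP[u _ <-]
                        |exact: finite_image_norm].
have [||t tz tI] := gaschutz (b := tuple_image f z) aI MI.
- by rewrite generated_by_sub; apply/fintype.forallP => i; rewrite ffunE.
- apply/fintype.subsetP => _ /finite_imageP[u _ <-].
  have [n Nn h] := zN G f qf u.
  apply/mulsgP; exists (f u * f n)%g (f n)^-1%g => //; last by rewrite mulgK.
  by rewrite groupV mem_finite_image.
have /fin_all_exists[n hn] i : exists n, nsub_set N n /\ t i = f (z i * n)%g.
  have := tz i; rewrite mem_lcoset ffunE => /finite_imageP[n Nn fn].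
  by exists n; split=> //; rewrite fM fn mulKVg.
exists (fun i => z i * n i)%g => [i|u]; first by rewrite mulKg; case: (hn i).
suff -> : tuple_image f (fun i => z i * n i)%g = t by rewrite tI.
by apply/ffunP => i; rewrite ffunE; case: (hn i).
Qed.

(** The lifts of z form a product of closed cosets, compact by Tychonoff. Those that generate in the
    quotient f form a nonempty set [Y G f], and these sets generate a filter since two quotients are
    dominated by their pair. A cluster point works for every f, because f is locally constant. *)
Lemma gaschutz_profinite (N : normalSubgroup F) (z : 'I_d -> F) :
  closed (nsub_set N) -> generates_mod N z ->
  exists2 y : 'I_d -> F,
    (forall i, nsub_set N ((z i)^-1 * y i)%g) & generates y.
Proof.
move=> clN zN; have [cF _ _] := profF.
pose lifts (y : 'I_d -> F) := forall i, nsub_set N ((z i)^-1 * y i)%g.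
pose K : set ('I_d -> F) := [set y | lifts y].
have cK : @compact (prod_topology (fun _ : 'I_d => F)) K.
  apply: (@tychonoff 'I_d (fun=> F)
    (fun i => [set u | nsub_set N ((z i)^-1 * u)%g])) => i.
  apply: (subclosed_compact _ cF) => //.
  have /continuous_closedP := @mulgl_continuous F (z i)^-1%g.
  by apply.
pose Y (G : finGroupType) (f : F -> G) : set ('I_d -> F) :=
  [set y | lifts y /\ forall u, f u \in generated_by (tuple_image f y)].
pose Phi : set_system (prod_topology (fun _ : 'I_d => F)) :=
  [set B | exists (G : finGroupType) (f : F -> G),
    finite_quotient f /\ Y G f `<=` B].
have FPhi : ProperFilter Phi.
  split.
    move=> [G [f [qf]]].
    have [y yz yf] := gaschutz_finite_quotient zN qf.
    by move=> /(_ y); apply.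
  split.
  (* [{perm bool}] is an arbitrary finite group, taken with the trivial map. *)
  - by exists {perm bool}, (fun=> 1%g); split=> //; exact: finite_quotient_cst.
  - move=> A B [G1 [f1 [q1 A1]]] [G2 [f2 [q2 B2]]].
    exists (G1 * G2)%type, (fun u => (f1 u, f2 u)); split.
      exact: finite_quotient_pair.
    move=> y [yz yf]; split; [apply: A1|apply: B2]; split=> // u;
      by have /generated_by_pair[] := yf u.
  - move=> A B AB [G [f [qf YA]]]; exists G, f; split=> //.
    exact: subset_trans AB.
have PhiK : Phi K.
  exists {perm bool}, (fun=> 1%g).
  by split; [exact: finite_quotient_cst|move=> y []].
have [y [Ky cly]] := cK Phi FPhi PhiK.
exists y => // G f qf u.
have PhiY : Phi (Y G f) by exists G, f; split.
have [_ fc] := qf.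
have ny : nbhs (y : prod_topology (fun _ : 'I_d => F))
    [set y' | forall i, f (y' i) = f (y i)].
  have FFy : Filter (nbhs (y : prod_topology (fun _ : 'I_d => F))).
    exact: nbhs_filter.
  apply: (@filter_forall _ 'I_d
    (fun i => [set y' : 'I_d -> F | f (y' i) = f (y i)]) _ FFy) => i.
  exact: (@proj_continuous _ (fun=> F) i y _ (fc (y i))).
have [y' [[_ h] e]] := cly _ _ PhiY ny.
suff <- : tuple_image f y' = tuple_image f y by exact: h.
by apply/ffunP => i; rewrite !ffunE.
Qed.
(** The endomorphism sending the basis to y has a closed image by compactness, and this image agrees
    with F in every finite quotient, so it is onto. It is one-to-one by the Hopfian argument. *)
Lemma generates_aut (y : 'I_d -> F) : generates y ->
  exists a : group_aut F, forall i, a (x i) = y i.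
Proof.
move=> yF; have [cF hF _] := profF.
have [a [[ac aM ax] _]] := F_free.2 F y profF.
have a_surj w : range a w.
  apply: closed_separated => //.
    apply: compact_closed => //.
    by apply: continuous_compact => //; exact: continuous_subspaceT.
  move=> G f qf.
  have qfa := finite_quotient_comp qf aM ac; have [faM _] := qfa.
  have : f w \in finite_image_group faM (subgroup_setT F).
    move: (yF G f qf w); apply/fintype.subsetP; rewrite generated_by_sub.
    apply/fintype.forallP => i; rewrite ffunE -ax.
    exact: (@mem_finite_image _ _ _ _ faM).
  by move=> /finite_imageP[u _ /= <-]; exists (a u) => //; exists u.
have a_ker u : a u = 1%g -> u = 1%g.
  move=> au; apply: (closed_separated profF (N := [set 1%g])).
    exact: (accessible_closed_set1 (hausdorff_accessible hF)).
  move=> G f qf; exists 1%g => //.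
  have [fM _] := qf.
  (* Precomposition with [a] permutes the finite set of homomorphisms from    *)
  (* [F] to [G], encoded by the images of the basis.                          *)
  have /choice[h hP] (t : {ffun 'I_d -> G}) :
      exists g : F -> G, finite_quotient g /\ forall i, g (x i) = t i.
    by have [g qg gx] := free_finite_quotient t; exists g.
  pose T t := tuple_image (h t) y.
  have T_inj : injective T.
    move=> t t' /ffunP tt'; apply/ffunP => i.
    have [qt tx] := hP t; have [qt' tx'] := hP t'.
    rewrite -tx -tx'; suff -> : h t = h t' by [].
    have e : h t \o a = h t' \o a.
      apply: finite_quotient_eq => [||j]; try exact: finite_quotient_comp.
      by have := tt' j; rewrite !ffunE /= ax.
    by apply/funext => w; have [v _ <-] := a_surj w; exact: (congr1 (@^~ v) e).
  have [T' _ TK] := injF_bij T_inj.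
  (* As [T] is onto, f factors through [a], so f kills the kernel of [a]; the finite quotients f
     separate points. *)
  pose t := T' (tuple_image f x); have [qt tx] := hP t.
  have e : h t \o a = f.
    apply: finite_quotient_eq => // [|j]; first exact: finite_quotient_comp.
    have := TK (tuple_image f x) => /ffunP /(_ j).
    by rewrite !ffunE /= ax.
  have <- : h t (a u) = f u by rewrite -e.
  by rewrite au (morph_mul1 fM) (morph_mul1 qt.1).
have a_inj : injective a.
  move=> u v auv; apply: (mulgI v^-1%g); rewrite mulVg; apply: a_ker.
  by rewrite aM auv (morph_mulV aM) mulVg.
have a_bij : bijective a.
  have /choice[b ab] w : exists u, a u = w.
    by have [u _ uw] := a_surj w; exists u.
  by exists b => // u; apply: a_inj; rewrite ab.
by exists (GroupAut aM a_bij ac).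
Qed.

End Free.

(** * Lifting automorphisms of F / N to F *)

Section QuotientOfFiniteQuotient.
Variables (F : topologicalGroupType) (N : normalSubgroup F).
Variables (G : finGroupType) (f : F -> G) (qf : finite_quotient f).

Let fM : {morph f : u v / (u * v)%g} := qf.1.
Local Notation M := (finite_image_group fM (nsub_subgroup N)).

(** The homomorphism from F / N to f(F) / f(N) induced by f, with values in the larger group N(M) /
    M where M = f(N). *)
Definition coset_quotient (e : coset_type N) : coset_of M :=
  coset M (f (repr e)).

Let norm_f u : f u \in 'N(M)%g.
Proof.
by apply: (fintype.subsetP (finite_image_norm N fM)); exact: mem_finite_image.
Qed.

Lemma coset_eq_image u v :
  coset M (f u) = coset M (f v) <->
  exists2 n, nsub_set N n & f n = ((f u)^-1 * f v)%g.
Proof.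
split=> [/esym /rcoset_kercosetP|[n Nn fn]].
  move=> /(_ (norm_f _) (norm_f _)); rewrite norm_rlcoset // mem_lcoset.
  by move=> /finite_imageP.
apply/esym/rcoset_kercosetP; rewrite ?norm_f //.
rewrite norm_rlcoset ?norm_f // mem_lcoset -fn; exact: mem_finite_image.
Qed.

Lemma coset_quotientE u : coset_quotient (pcoset N u) = coset M (f u).
Proof.
apply/coset_eq_image; exists ((repr (pcoset N u))^-1 * u)%g.
  exact/pcosetP/pcoset_repr.
by rewrite fM morph_mulV.
Qed.

Lemma finite_quotient_coset : finite_quotient coset_quotient.
Proof.
split=> [a b|].
  have [u <-] := pcoset_surj a; have [v <-] := pcoset_surj b.
  by rewrite -pcosetM !coset_quotientE fM morphM.
apply/finite_quotient_continuous/coset_continuous/finite_quotient_continuous.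
by move=> u; apply: filterS (qf.2 u) => v fvu /=; rewrite !coset_quotientE fvu.
Qed.

End QuotientOfFiniteQuotient.

Lemma free_profinite_lift_aut (d : nat) (F : topologicalGroupType)
    (x : 'I_d -> F) (N : normalSubgroup F)
    (phi : coset_type N -> coset_type N) :
  free_profinite x -> closed (nsub_set N) ->
  {morph phi : a b / (a * b)%g} -> continuous phi -> bijective phi ->
  exists a : group_aut F, forall u, pcoset N (a u) = phi (pcoset N u).
Proof.
move=> F_free clN phiM phic [phi' _ phiK].
have qp (G : finGroupType) (f : F -> G) (qf : finite_quotient f) :
    finite_quotient (coset_quotient (N := N) qf \o pcoset N).
  apply: finite_quotient_comp; first exact: finite_quotient_coset.
    exact: pcosetM.
  exact: pcoset_continuous.
have qpp (G : finGroupType) (f : F -> G) (qf : finite_quotient f) :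
    finite_quotient (coset_quotient (N := N) qf \o phi \o pcoset N).
  apply: finite_quotient_comp; last exact: pcoset_continuous.
    apply: finite_quotient_comp => //; exact: finite_quotient_coset.
  exact: pcosetM.
pose z i := repr (phi (pcoset N (x i))).
have zE i : pcoset N (z i) = phi (pcoset N (x i)) by exact: pcoset_repr.
(* As phi is onto, u N = phi(v N) for some v; since the basis generates F, the image of u modulo
   f(N) is a product of images of the z i and their inverses. *)
have zN : generates_mod N z.
  move=> G f qf u; pose M := finite_image_group qf.1 (nsub_subgroup N).
  have [v vu] := pcoset_surj (phi' (pcoset N u)).
  have := finite_quotient_generated F_free v (qpp G f qf).
  rewrite [X in X \in _]/= vu phiK coset_quotientE.
  pose L := generated_by (tuple_image f z).
  have /fintype.subsetP sub : (generated_by (tuple_image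
      (coset_quotient (N := N) qf \o phi \o pcoset N) x) \subset
      quotient.quotient L M).
    rewrite generated_by_sub; apply/fintype.forallP => i.
    rewrite ffunE [X in X \in _]/= -zE coset_quotientE.
apply: mem_quotient; have := mem_generated_by (tuple_image f z) i.
    by rewrite ffunE.
  move=> /sub /morphimP[l nl Ll] /esym /rcoset_kercosetP.
  have nu : f u \in 'N(M)%g.
    apply: (fintype.subsetP (finite_image_norm N qf.1)).
    exact: mem_finite_image.
  move=> /(_ nl nu); rewrite norm_rlcoset // mem_lcoset.
  move=> /finite_imageP[n Nn fn].
  by exists n => //; rewrite fn mulKVg.
have [y yz yF] := gaschutz_profinite F_free clN zN.
have [a ax] := generates_aut F_free yF.
exists a => u; rewrite -[RHS]pcoset_repr; apply/esym/pcosetP.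
(* As N is closed, it is enough to compare both sides modulo f(N) for each finite quotient f, where
   two homomorphisms on F agree once they agree on the basis. *)
apply: closed_separated clN _ => [|G f qf]; first exact: F_free.1.
have e : coset_quotient (N := N) qf \o pcoset N \o a =
    coset_quotient (N := N) qf \o phi \o pcoset N.
  apply: (finite_quotient_eq F_free) => // [|i].
    by apply: finite_quotient_comp => //; [exact: gautM|exact: gaut_continuous].
  rewrite /= ax -zE; congr coset_quotient; exact/esym/pcosetP.
have /= := congr1 (@^~ u) e.
rewrite coset_quotientE => /esym /coset_eq_image[n Nn fn].
by exists n => //; rewrite fn qf.1 (morph_mulV qf.1).
Qed.

(** * Automorphisms of extensions *)

Section LiftingAutomorphisms.
Variables (A : topologicalZmodType) (E : groupType) (H : finGroupType).
Variables (X : extension A E H) (g : GL A).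

Local Notation i := (ext_inj X).
Local Notation q := (ext_proj X).
Local Notation t := (ext_section X).
Local Open Scope ring_scope.

Definition extends_to (phi : E -> E) : Prop :=
  [/\ {morph phi : u v / (u * v)%g}, forall a, phi (i a) = i (g a)
    & forall e, q (phi e) = q e].

(** [phi] maps the chosen section to another one, whose factor set is g applied to the old factor
    set, and the class does not depend on the section. *)
Lemma extends_to_AutH_beta phi : extends_to phi -> AutH_beta X g.
Proof.
move=> [phiM phii phiq].
have gH : AutH X g.
  move=> h a; apply: (@ext_inj_injective _ _ _ X).
  have [e <-] := ext_proj_surj X h.
  rewrite -phii ext_actE -(phiq e) ext_actE !phiM phii.
  by rewrite (morph_mulV phiM).
exists gH; rewrite /ext_class H2_map_class.
have [qt tM] := ext_factor_set X.
have sf : factor_set X (phi \o t) (Z2_map gH (ext_cocycle X)).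
  split=> [h|h k /=]; first by rewrite /= phiq ext_sectionK.
  by rewrite -phiM tM phiM phii; congr (i _ * _)%g; rewrite [RHS]ffunE.
rewrite -/(ext_class X) (ext_classE sf); congr H2_class.
exact: val_inj.
Qed.

(** Every element of E is uniquely i(a) t(h). In these coordinates, multiplicativity of phi amounts
    to the identity that c has the coboundary g f - f, where f is the factor set. *)
Lemma AutH_beta_extends_to : AutH_beta X g -> exists phi, extends_to phi.
Proof.
move=> [gH]; rewrite /ext_class H2_map_class => /H2_classP[c /ffunP gc].
have {}gc h k : g (ext_cochain X (h, k)) - ext_cochain X (h, k) =
    ext_module X h (c k) - c (h * k)%g + c h.
  move: (gc (h, k)); rewrite [X in _ = X -> _]ffunE /=.
  by move: (ext_cochain X) => f; rewrite !ffunE.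
have [qt tM] := ext_factor_set X.
have qK e : q (e * (t (q e))^-1)%g = 1%g.
  by rewrite ext_projM ext_projV ext_sectionK mulgV.
pose r e := ext_retract (qK e).
have rK e : (i (r e) * t (q e))%g = e by rewrite ext_retractK mulgVK.
have qit a h : q (i a * t h)%g = h.
  by rewrite ext_projM ext_proj_inj ext_sectionK mul1g.
have rit a h : r (i a * t h)%g = a.
  apply: (@ext_inj_injective _ _ _ X); apply: (mulIg (t h)).
  by rewrite -{2}(qit a h) rK.
pose phi e := (i (g (r e) + c (q e)) * t (q e))%g.
have phiE a h : phi (i a * t h)%g = (i (g a + c h) * t h)%g.
  by rewrite /phi qit rit.
have itM a h b k : (i a * t h * (i b * t k) =
    i (a + ext_act X h b + ext_cochain X (h, k)) * t (h * k)%g)%g.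
  have ae : (i (ext_act X h b) = t h * i b * (t h)^-1)%g.
    by rewrite -{1}(qt h) ext_actE.
  rewrite !ext_injD ae -!mulgA -tM.
  by rewrite mulKg.
have phiM : {morph phi : u v / (u * v)%g}.
  move=> u v; rewrite -(rK u) -(rK v); move: (r u) (q u) (r v) (q v).
  move=> a h b k; rewrite itM !phiE itM; congr (i _ * _)%g.
  have hD := ext_actD X.
  have gM : forall h a, g (ext_act X h a) = ext_act X h (g a) := gH.
  rewrite hD !raddfD gM; move: (gc h k) => /eqP; rewrite subr_eq => /eqP -> /=.
  rewrite -!addrA; congr (_ + _).
  rewrite (addrA (c h)) (addrC (- c _)) addrK.
  by rewrite (addrCA _ (c h)) (addrCA _ (c h)).
exists phi; split=> //.
(* The section is not normalised: t(1) = i(u). The coboundary identity at (1, 1) gives c(1) = g(u) -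
   u, which cancels this defect. *)
- move=> a; pose u := ext_cochain X (1%g, 1%g).
  have t1 : t 1%g = i u by apply: (mulIg (t 1%g)); rewrite tM mulg1.
  have gu : g u = c 1%g + u.
    apply/eqP; rewrite -subr_eq gc mulg1 /= ext_act1 addrN add0r //.
  have -> : i a = (i (a - u) * t 1%g)%g by rewrite t1 -ext_injD subrK.
  by rewrite phiE t1 -ext_injD -addrA -gu -raddfD subrK.
- by move=> e; rewrite /phi qit.
Qed.

(** The five lemma, with g on the kernel and the identity on H. *)
Lemma extends_to_bij phi : extends_to phi -> bijective phi.
Proof.
move=> [phiM phii phiq].
have ker u : phi u = 1%g -> u = 1%g.
  move=> pu; have : q u = 1%g by rewrite -phiq pu ext_proj1.
  move=> /ext_exact[a au]; move: pu; rewrite -au phii -(ext_inj0 X).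
  move=> /ext_inj_injective ga0.
  by rewrite (bij_inj (zaut_bij g) (etrans ga0 (esym (raddf0 g)))).
have inj : injective phi.
  move=> u v puv; apply: (mulgI v^-1%g); rewrite mulVg; apply: ker.
  by rewrite phiM puv (morph_mulV phiM) mulVg.
have [g' _ gK] := zaut_bij g.
have /choice[b bK] w : exists u, phi u = w.
  have : q ((phi w)^-1 * w)%g = 1%g by rewrite ext_projM ext_projV phiq mulVg.
  move=> /ext_exact[a aw]; exists (w * i (g' a))%g.
  by rewrite phiM phii gK aw mulKVg.
by exists b => // u; apply: inj; rewrite bK.
Qed.

End LiftingAutomorphisms.

Lemma morph_continuous (E E' : topologicalGroupType) (phi : E -> E') :
  {morph phi : u v / (u * v)%g} -> {for 1%g, continuous phi} -> continuous phi.
Proof.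
move=> phiM c1 e.
have -> : phi = (fun u => phi e * u)%g \o (phi \o (fun u => e^-1 * u)%g).
  by apply/funext => u /=; rewrite -phiM mulKVg.
have ce : {for e, continuous (phi \o (fun u => e^-1 * u)%g)}.
  apply: continuous_comp; first exact: mulgl_continuous.
  by rewrite mulVg.
apply: continuous_comp ce _; exact: mulgl_continuous.
Qed.

Lemma GL_eq (A : topologicalZmodType) (g g' : GL A) :
  (forall a, g a = g' a) -> g = g'.
Proof.
case: g g' => [f fb fc] [f' fb' fc'] /= ff'.
have e : f = f'.
  case: f f' ff' {fb fc fb' fc'} => [f [[h]]] [f' [[h']]] /= ff'.
  have {}ff' : f = f' by exact/funext.
  by case: _ / ff' h' => h'; rewrite (Prop_irrelevance h h').
case: _ / e fb' fc' {ff'} => fb' fc'.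
by rewrite (Prop_irrelevance fb fb') (Prop_irrelevance fc fc').
Qed.

(** * The extension of H by R / I *)

Section QuotientExtension.
Variables (F : topologicalGroupType) (H : finGroupType).
Variables (pi : {multiplicative F -> H}) (I : normalSubgroup F).
Hypothesis pi_surj : forall h, exists u, pi u = h.
Hypothesis comm_sub : closed_commutator (kernel pi) `<=` I.
Hypothesis sub_ker : I `<=` kernel pi.

Local Notation X := (quotient_extension pi_surj comm_sub sub_ker).

(** Since H is discrete, R / I is an open subgroup of F / I. There phi is g, so it is continuous at
    1, hence everywhere. *)
Lemma extends_to_continuous (g : GL (Rtilde comm_sub)) phi :
  continuous (pi : F -> discrete_topology H) ->
  extends_to X g phi -> continuous phi.
Proof.
move=> pi_cont [phiM phii phiq]; apply: morph_continuous => // V.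
rewrite (morph_mul1 phiM) => V1.
have oK : open (pcoset I @` kernel pi).
  apply: pcoset_open; have /continuousP := pi_cont.
  by move=> /(_ [set 1%g]); apply; exact: discrete_open.
have c0 : {for 0%R, continuous (@Rtilde_inj _ _ _ _ comm_sub \o g)}.
  apply: continuous_comp; first exact: zaut_continuous.
  exact: asub_val_continuous.
have : nbhs (0%R : Rtilde comm_sub)
    ((@Rtilde_inj _ _ _ _ comm_sub \o g) @^-1` V).
  by apply: c0; rewrite /= raddf0.
(* By definition of the subspace topology, U is open in F / I and only its trace on R / I is sent
   into V. *)
case=> _ [/= [U oU <-] U0 sUV].
suff : nbhs (1%g : coset_type I) (phi @^-1` V) by [].
apply: (filterS (P := U `&` (pcoset I @` kernel pi))).
  move=> e [Ue [u Ru ue]]; have := sUV (Rtilde_class comm_sub Ru).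
  rewrite -ue in Ue *; move=> /(_ Ue) /=.
  by have /= <- := phii (Rtilde_class comm_sub Ru).
apply: filterI; apply: open_nbhs_nbhs; split=> //.
by exists 1%g => //; exact: pi1.
Qed.

Lemma rho_extends (a : A_pi_I pi I) :
  extends_to X (rho comm_sub a) (coset_map a).
Proof.
split=> [u v|z|e].
- have [x <-] := pcoset_surj u; have [y <-] := pcoset_surj v.
  by rewrite -pcosetM !coset_mapE gautM pcosetM.
- by [].
- have [x <-] := pcoset_surj e.
  by rewrite coset_mapE /= !quotient_projE // A_pi_IE.
Qed.

End QuotientExtension.

Theorem theorem2p1 (d : nat) (d_ge1 : (1 <= d)%N)
  (F : topologicalGroupType) (x : 'I_d -> F) (F_free : free_profinite x)
  (H : finGroupType) (pi : {multiplicative F -> H})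
  (pi_cont : continuous (pi : F -> discrete_topology H))
  (pi_surj : forall h, exists u, pi u = h)
  (I : normalSubgroup F) (I_closed : closed (nsub_set I))
  (comm_sub : closed_commutator (kernel pi) `<=` I)
  (sub_ker : I `<=` kernel pi) :
  range (@rho F H pi I comm_sub) =
  AutH_beta (quotient_extension pi_surj comm_sub sub_ker).
Proof.
apply/seteqP; split=> [_ [a _ <-]|g].
  exact: extends_to_AutH_beta (rho_extends _ _ _ a).
move=> /AutH_beta_extends_to[phi phiX]; have [phiM phii phiq] := phiX.
have [a aphi] := free_profinite_lift_aut F_free I_closed phiM
  (extends_to_continuous pi_cont phiX) (extends_to_bij phiX).
have aA : A_pi_I pi I a.
  split.
    apply/funext => u /=; rewrite -!(quotient_projE sub_ker) aphi.
    exact: phiq.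
  (* I is the kernel of F -> F / I, and phi is injective on F / I. *)
  have aI u : nsub_set I (a u) <-> nsub_set I u.
    rewrite -!pcoset_eq1 aphi; split=> [|->]; last exact: morph_mul1.
    rewrite -[X in _ = X -> _](morph_mul1 phiM).
    exact: (bij_inj (extends_to_bij phiX)).
  apply/seteqP; split=> [_ [u Iu <-]|v Iv]; first exact/aI.
  have [b _ bK] := gaut_bij a.
  by exists (b v) => //; apply/aI; rewrite bK.
exists (exist _ a (mem_set aA)) => //.
apply: GL_eq => z; apply: asub_val_inj.
have [u [Ru ->]] := Rtilde_classP z.
transitivity (phi (pcoset I u)); last exact: (phii (Rtilde_class comm_sub Ru)).
rewrite -aphi; exact: coset_mapE.
Qed.
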